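(* Let $X\in\mathbb{H}^{n\times m}$, $S\in\mathbb{H}^{k\times m}$ and $T\in\mathbb{H}^{n\times l}$. Then: (a) $\mathcal{R}_l(X)\subseteq\mathcal{R}_l(S)$ if and only if there exists $U\in\mathbb{H}^{n\times k}$ such that $X=US$. (b) $\mathcal{N}_l(T)\subseteq\mathcal{N}_l(X)$ if and only if there exists $V\in\mathbb{H}^{l\times m}$ such that $X=TV$.
   Context: $\mathbb{H}$ denotes the real quaternions. For $B\in\mathbb{H}^{p\times q}$, $\mathcal{R}_l(B)=\{xB : x\in\mathbb{H}^{1\times p}\}$ and $\mathcal{N}_l(B)=\{x\in\mathbb{H}^{1\times p} : xB=0\}$ are the left range and left null space. *)

(* Defs.v *)
From HB Require Import structures.
From mathcomp Require Import all_boot all_order all_algebra.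
From mathcomp Require Import ring.
From mathcomp Require Import boolp classical_sets reals.

Set Implicit Arguments.
Unset Strict Implicit.
Unset Printing Implicit Defensive.

Import Order.TTheory GRing.Theory Num.Theory.
Local Open Scope ring_scope.
Local Open Scope classical_set_scope.

(* [Quat a b c d] is a + b i + c j + d k with i^2 = j^2 = k^2 = ijk = -1. *)
Record quaternion (R : Type) : Type :=
  Quat { qre : R; qi : R; qj : R; qk : R }.

Section QuaternionChoice.
Variable R : Type.

Definition tuple_of_quat (x : quaternion R) : R * R * R * R :=
  let: Quat a b c d := x in (a, b, c, d).
Definition quat_of_tuple (t : R * R * R * R) : quaternion R :=
  let: (a, b, c, d) := t in Quat a b c d.

Lemma tuple_of_quatK : cancel tuple_of_quat quat_of_tuple.
Proof. by case. Qed.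

End QuaternionChoice.

HB.instance Definition _ (R : eqType) :=
  Equality.copy (quaternion R) (can_type (@tuple_of_quatK R)).
HB.instance Definition _ (R : choiceType) :=
  Choice.copy (quaternion R) (can_type (@tuple_of_quatK R)).

Section QuaternionRing.
Variable R : realType.
Local Notation H := (quaternion R).
Implicit Types x y z : H.

Definition addq x y : H :=
  let: Quat a b c d := x in let: Quat a' b' c' d' := y in
  Quat (a + a') (b + b') (c + c') (d + d').
Definition oppq x : H :=
  let: Quat a b c d := x in Quat (- a) (- b) (- c) (- d).
Definition mulq x y : H :=
  let: Quat a b c d := x in let: Quat a' b' c' d' := y in
  Quat (a * a' - b * b' - c * c' - d * d')
       (a * b' + b * a' + c * d' - d * c')
       (a * c' - b * d' + c * a' + d * b')
       (a * d' + b * c' - c * b' + d * a').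
Definition sqnormq x : R :=
  let: Quat a b c d := x in a ^+ 2 + b ^+ 2 + c ^+ 2 + d ^+ 2.
Definition invq x : H :=
  let: Quat a b c d := x in let n := sqnormq x in
  Quat (a / n) (- b / n) (- c / n) (- d / n).

Definition zeroq : H := Quat 0 0 0 0.
Definition oneq : H := Quat 1 0 0 0.

Lemma addqA : associative addq.
Proof. by move=> [????] [????] [????]; rewrite /= !addrA. Qed.
Lemma addqC : commutative addq.
Proof. by move=> [????] [????] /=; congr Quat; rewrite addrC. Qed.
Lemma add0q : left_id zeroq addq.
Proof. by move=> [????]; rewrite /= !add0r. Qed.
Lemma addNq : left_inverse zeroq oppq addq.
Proof. by move=> [????]; rewrite /= !addNr. Qed.

HB.instance Definition _ :=
  GRing.isZmodule.Build H addqA addqC add0q addNq.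

Lemma mulqA : associative mulq.
Proof. by move=> [????] [????] [????] /=; congr Quat; ring. Qed.
Lemma mul1q : left_id oneq mulq.
Proof. by move=> [????] /=; congr Quat; ring. Qed.
Lemma mulq1 : right_id oneq mulq.
Proof. by move=> [????] /=; congr Quat; ring. Qed.
Lemma mulqDl : left_distributive mulq addq.
Proof. by move=> [????] [????] [????] /=; congr Quat; ring. Qed.
Lemma mulqDr : right_distributive mulq addq.
Proof. by move=> [????] [????] [????] /=; congr Quat; ring. Qed.
Lemma oneq_neq0 : oneq != zeroq.
Proof. by apply/eqP => -[/eqP]; rewrite oner_eq0. Qed.

HB.instance Definition _ :=
  GRing.Zmodule_isNzRing.Build H mulqA mul1q mulq1 mulqDl mulqDr oneq_neq0.

Lemma sqnormq_neq0 x : x != 0 -> sqnormq x != 0.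
Proof.
apply: contraNneq; case: x => a b c d /= /eqP.
rewrite !paddr_eq0 ?addr_ge0 ?sqr_ge0 // !sqrf_eq0.
by move=> /andP[/andP[/andP[/eqP-> /eqP->] /eqP->] /eqP->].
Qed.

Definition unitq : pred H := fun x => x != 0.

Lemma mulVq : {in unitq, left_inverse 1 invq *%R}.
Proof.
move=> x /sqnormq_neq0; case: x => a b c d /= n0.
by congr Quat; field.
Qed.
Lemma mulqV : {in unitq, right_inverse 1 invq *%R}.
Proof.
move=> x /sqnormq_neq0; case: x => a b c d /= n0.
by congr Quat; field.
Qed.
Lemma unitqP x y : y * x = 1 /\ x * y = 1 -> unitq x.
Proof.
by case=> yx _; apply/eqP => x0; move/eqP: yx; rewrite x0 mulr0 eq_sym oner_eq0.
Qed.
Lemma invq_out : {in [predC unitq], invq =1 id}.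
Proof.
move=> x; rewrite inE negbK => /eqP ->.
by rewrite /= oppr0 !mul0r.
Qed.

HB.instance Definition _ :=
  GRing.NzRing_hasMulInverse.Build H mulVq mulqV unitqP invq_out.

End QuaternionRing.

Section LeftSpaces.
Variables (R : realType) (p q : nat).

Definition left_range (B : 'M[quaternion R]_(p, q)) :
  set 'rV[quaternion R]_q := [set x *m B | x in [set: 'rV[quaternion R]_p]].

Definition left_null (B : 'M[quaternion R]_(p, q)) :
  set 'rV[quaternion R]_p := [set x | x *m B = 0].

End LeftSpaces.

(* Main.v *)
(* Every matrix T over a division ring has a generalized inverse G, with
   T G T = T.  Since the rows of 1 - T G annihilate T, an inclusion of left null
   spaces gives (1 - T G) X = 0, that is X = T (G X). *)
Require Import Defs.
From mathcomp Require Import all_boot all_order all_algebra.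
From mathcomp Require Import classical_sets reals.
Import GRing.Theory.
Local Open Scope ring_scope.
Local Open Scope classical_set_scope.

(* Induction on the rows: either the new row t lies in the row space of the old
   matrix T, and G extends by a zero column, or some column g satisfies T g = 0
   and t g = 1. *)
Lemma mulmx_regular (D : unitRingType)
    (unitD : forall x : D, x != 0 -> x \is a GRing.unit)
    (n l : nat) (T : 'M[D]_(n, l)) :
  exists G : 'M[D]_(l, n), T *m G *m T = T.
Proof.
elim: n T => [|n IHn] T; first by exists 0; rewrite [LHS]flatmx0 [RHS]flatmx0.
rewrite -[n.+1]/(1 + n)%N in T *; rewrite -(vsubmxK T).
move: (usubmx T) (dsubmx T) => {T} t T; have [G TGT] := IHn T.
have [t0|/rV0Pn[j tj0]] := eqVneq (t *m (1%:M - G *m T)) 0.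
  exists (row_mx 0 G); rewrite -mulmxA mul_row_col mul0mx add0r mul_col_mx.
  rewrite (mulmxA T) TGT; congr col_mx.
  by move/eqP: t0; rewrite mulmxBr mulmx1 subr_eq0 => /eqP <-.
(* Take [g] to be column [j] of [1 - G T], scaled by [c] on the right because [D] need not
   commute. *)
pose c := ((t *m (1%:M - G *m T)) 0 j)^-1.
have [g Tg tg] : exists2 g : 'cV_l, T *m g = 0 & t *m g = 1%:M.
  exists ((1%:M - G *m T) *m delta_mx j 0 *m c%:M); rewrite !mulmxA.
    by rewrite mulmxBr mulmx1 (mulmxA T) TGT subrr !mul0mx.
  by rewrite -colE [col j _]mx11_scalar mxE -scalar_mxM mulrV // unitD.
(* The term [g t G] makes [t] kill the second block and, as [T g = 0], leaves [T G] intact: the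
   product is block diagonal, [1] and [T G]. *)
exists (row_mx g (G - g *m t *m G)).
rewrite mul_col_row Tg tg !mulmxBr !mulmxA tg Tg mul1mx !mul0mx subrr subr0.
by rewrite mul_block_col mul1mx !mul0mx addr0 add0r TGT.
Qed.

Lemma quaternion_unit (R : realType) (x : quaternion R) :
  x != 0 -> x \is a GRing.unit.
Proof. by []. Qed.

Theorem lemma3p15 (R : realType) (n m k l : nat)
    (X : 'M[quaternion R]_(n, m)) (S : 'M[quaternion R]_(k, m))
    (T : 'M[quaternion R]_(n, l)) :
  (left_range X `<=` left_range S <->
     exists U : 'M[quaternion R]_(n, k), X = U *m S) /\
  (left_null T `<=` left_null X <->
     exists V : 'M[quaternion R]_(l, m), X = T *m V).
Proof.
split; split.
- move=> XS.
  (* Each row of [X] lies in its left range; the chosen coefficient rows stack into [U]. *)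
  have /boolp.choice[u uS] : forall i, exists u, u *m S = row i X.
    move=> i; have [|u _ uS] := XS (row i X); last by exists u.
    by exists (delta_mx 0 i); rewrite ?rowE.
  exists (\matrix_i u i); apply/row_matrixP => i.
  by rewrite row_mul rowK uS.
- by move=> [U ->] _ [x _ <-]; exists (x *m U); rewrite ?mulmxA.
- move=> TX; have [G TGT] := mulmx_regular _ (@quaternion_unit R) _ _ T.
  exists (G *m X); apply/eqP; rewrite mulmxA -subr_eq0 -{1}(mul1mx X) -mulmxBl.
  apply/eqP/row_matrixP => i; rewrite row_mul row0; apply: TX.
  by rewrite /left_null /= -row_mul mulmxBl mul1mx TGT subrr row0.
- by move=> [V ->] x; rewrite /left_null /= mulmxA => ->; rewrite mul0mx.
Qed.
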